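(* Let $\mathbf{G}$ be any parameterized topology (a countable set of topologies). Then for all positive integers $k$ and $d$, the parameterized model checking problem for $\mathbf{G}$, process templates from $\mathcal{P}_u$, and specifications from $k$-indexed $\mathsf{CTL}^*_d\setminus\mathsf{X}$ has a cutoff; that is, there is a natural number $c$ such that for every $P\in\mathcal{P}_u$ and every such formula $\varphi$: $P^G\models\varphi$ for all $G\in\mathbf{G}$ with $|V_G|\le c$ if and only if $P^G\models\varphi$ for all $G\in\mathbf{G}$.
   Context: A labeled transition system (LTS) over a set of atoms is a tuple $(Q,Q_0,\Sigma,\delta,\lambda)$ with state set $Q$, initial states $Q_0\subseteq Q$, action labels $\Sigma$, transition relation $\delta\subseteq Q\times\Sigma\times Q$, and labeling $\lambda$ mapping each state to a finite set of atoms. Fix a countably infinite set $\mathsf{AP}_{pr}$ of atoms and a finite nonempty set $\Sigma_{int}$ of internal labels; let $\Sigma_{pr}=\Sigma_{int}\cup\{\mathsf{snd},\mathsf{rcv}\}$. A process template $P\in\mathcal{P}_u$ is an LTS $(Q,Q_0,\Sigma_{pr},\delta,\lambda)$ over $\mathsf{AP}_{pr}$ such that: $Q$ is finite and partitioned into nonempty sets $T$ (states ''having the token'') and $N$; $Q_0=\{\iota_t,\iota_n\}$ with $\iota_t\in T,\iota_n\in N$; every $\mathsf{snd}$-transition goes from $T$ to $N$; every $\mathsf{rcv}$-transition goes from $N$ to $T$; every internal transition goes from $T$ to $T$ or from $N$ to $N$; every state has an outgoing transition; and every infinite sequence of action labels along a path lies in $(\Sigma_{int}^*\,\mathsf{snd}\,\Sigma_{int}^*\,\mathsf{rcv})^\omega\cup(\Sigma_{int}^*\,\mathsf{rcv}\,\Sigma_{int}^*\,\mathsf{snd})^\omega$.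 A topology is a directed graph $G=(V,E,x)$ with $V=[n]$ for some $n\ge1$, initial vertex $x\in V$, and $E\subseteq V\times V$ without self-loops. The token-passing system $P^G$ is the LTS with states $Q^V$ (functions $s:V\to Q$); unique initial state $s_0$ with $s_0(x)=\iota_t$ and $s_0(v)=\iota_n$ for $v\neq x$; labeling: $p_i$ holds in $s$ iff $p\in\lambda(s(i))$; transitions: internal transitions $(s,a,s')$, $a\in\Sigma_{int}$, where one vertex $v$ takes a local transition $s(v)\xrightarrow{a}s'(v)$ and all other vertices are unchanged; and token-passing transitions $(s,\mathsf{tok},s')$ where for some $(v,w)\in E$, $s(v)\xrightarrow{\mathsf{snd}}s'(v)$ and $s(w)\xrightarrow{\mathsf{rcv}}s'(w)$ are local transitions and all other vertices are unchanged. $\mathsf{CTL}^*_d\setminus\mathsf{X}$ is the fragment of $\mathsf{CTL}^*$ without the next-time operator in which the nesting depth of path quantifiers is at most $d$. A $k$-indexed $\mathsf{CTL}^*_d\setminus\mathsf{X}$ formula has the form $Q_1x_1\dots Q_kx_k.\,\varphi$ where each $Q_ix_i$ is an index quantifier ($\forall$ or $\exists$ over vertices, possibly restricted as $x\in Y$ for a set $Y$ of index variables or $x\in E(y)$ for the out-neighbours of the vertex denoted by $y$) and $\varphi$ is a $\mathsf{CTL}^*_d\setminus\mathsf{X}$ formula over atoms $p_{x_j}$ ($p\in\mathsf{AP}_{pr}$, $j\le k$). Semantics: $P^G\models Q_1x_1\dots Q_kx_k.\varphi$ iff $Q_1g_1\in V_G\dots Q_kg_k\in V_G$: $P^G\models\varphi[p_{x_j}\mapsto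 p_{g_j}]$. *)

(* Defs.v *)
From HB Require Import structures.
From mathcomp Require Import all_boot finmap.

Set Implicit Arguments.
Unset Strict Implicit.
Unset Printing Implicit Defensive.

Definition infinite_type (T : Type) : Prop :=
  exists f : nat -> T, injective f.

Record lts (A : choiceType) (L Q : Type) := Lts {
  init : Q -> Prop;
  step : Q -> L -> Q -> Prop;
  label : Q -> {fset A}
}.

(* The word u with letters in L belongs to W^omega: it is cut at positions
   0 = cut 0 < cut 1 < ... into consecutive factors that all lie in W. *)
Definition omega_power (L : Type) (W : seq L -> Prop) (u : nat -> L) : Prop :=
  exists cut : nat -> nat,
    [/\ cut 0 = 0,
        forall i, cut i < cut i.+1 &
        forall i, W [seq u j | j <- iota (cut i) (cut i.+1 - cut i)]].

Inductive action (Sint : Type) := Internal of Sint | Snd | Rcv.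
Arguments Snd {Sint}.
Arguments Rcv {Sint}.

(* The language Sint^* a Sint^* b. *)
Definition block (Sint : Type) (a b : action Sint)
    (u : seq (action Sint)) : Prop :=
  exists x y : seq Sint,
    u = [seq Internal i | i <- x] ++ a :: [seq Internal i | i <- y] ++ [:: b].

(* [holds] is the set T of states that have the token; N is its complement.
   Both are nonempty because of [iota_t] and [iota_n]. *)
Record template (AP : choiceType) (Sint : Type) := Template {
  tstate : finType;
  tlts :> lts AP (action Sint) tstate;
  holds : {set tstate};
  iota_t : tstate;
  iota_n : tstate;
  iota_tP : iota_t \in holds;
  iota_nP : iota_n \notin holds;
  initP : forall q, init tlts q <-> q = iota_t \/ q = iota_n;
  sndP : forall q q', step tlts q Snd q' -> q \in holds /\ q' \notin holds;
  rcvP : forall q q', step tlts q Rcv q' -> q \notin holds /\ q' \in holds;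
  internalP : forall q a q',
    step tlts q (Internal a) q' -> (q \in holds) = (q' \in holds);
  totalP : forall q, exists a q', step tlts q a q';
  alternateP : forall (q : nat -> tstate) (a : nat -> action Sint),
    (forall i, step tlts (q i) (a i) (q i.+1)) ->
    omega_power (block Snd Rcv) a \/ omega_power (block Rcv Snd) a
}.

Definition loopless (n : nat) (E : {set 'I_n * 'I_n}) : bool :=
  [forall v, (v, v) \notin E].

(* V = 'I_gsize, and gsize >= 1 because of the initial vertex [start]. *)
Record topology := Topology {
  gsize : nat;
  edges : {set 'I_gsize * 'I_gsize};
  start : 'I_gsize;
  no_loop : loopless edges
}.

(* The topologies form a countable type, so that every set of topologies is
   countable. *)
Definition topology_code (G : topology) :
    {n : nat & ({set 'I_n * 'I_n} * 'I_n)%type} :=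
  Tagged (fun n => ({set 'I_n * 'I_n} * 'I_n)%type) (edges G, start G).

Definition topology_decode
    (u : {n : nat & ({set 'I_n * 'I_n} * 'I_n)%type}) : option topology :=
  let: existT n (E, x) := u in
  omap (fun E' : {E : {set 'I_n * 'I_n} | loopless E} =>
          @Topology n (val E') x (valP E'))
       (insub E).

Lemma topology_codeK : pcancel topology_code topology_decode.
Proof.
case=> n E x h; rewrite /topology_decode /= insubT /=.
by congr (Some (Topology _ _)); apply: bool_irrelevance.
Qed.

HB.instance Definition _ := Countable.copy topology (pcan_type topology_codeK).

Inductive sys_action (Sint : Type) := SysInternal of Sint | Tok.
Arguments Tok {Sint}.

Section System.
Variables (AP : choiceType) (Sint : Type) (P : template AP Sint) (G : topology).

Definition vertex := 'I_(gsize G).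
Definition sys_state := {ffun vertex -> tstate P}.

Definition sys_init (s : sys_state) : Prop :=
  s = [ffun v => if v == start G then iota_t P else iota_n P].

Definition sys_step (s : sys_state) (a : sys_action Sint) (s' : sys_state) :
    Prop :=
  match a with
  | SysInternal b =>
      exists v : vertex,
        step P (s v) (Internal b) (s' v) /\
        forall u, u != v -> s' u = s u
  | Tok =>
      exists v w : vertex,
        [/\ (v, w) \in edges G,
            step P (s v) Snd (s' v),
            step P (s w) Rcv (s' w) &
            forall u, u != v -> u != w -> s' u = s u]
  end.

(* The atom p_v of the system is encoded as the pair (p, v). *)
Definition sys_label (s : sys_state) : {fset AP * vertex} :=
  [fset (p, v) | v : vertex in vertex, p : AP in label P (s v)]%fset.

Definition system : lts (AP * vertex)%type (sys_action Sint) sys_state :=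
  Lts sys_init sys_step sys_label.

End System.

(* CTL* without X. The universal path quantifier and the remaining boolean and
   temporal operators are the usual abbreviations, which do not change the
   nesting depth of path quantifiers. *)
Inductive sform (A : Type) :=
  | STrue
  | SAtom of A
  | SNeg of sform A
  | SAnd of sform A & sform A
  | SEx of pform A
with pform (A : Type) :=
  | PState of sform A
  | PNeg of pform A
  | PAnd of pform A & pform A
  | PUntil of pform A & pform A.
Arguments STrue {A}.

Fixpoint sdepth (A : Type) (f : sform A) : nat :=
  match f with
  | STrue | SAtom _ => 0
  | SNeg f1 => sdepth f1
  | SAnd f1 f2 => maxn (sdepth f1) (sdepth f2)
  | SEx g => (pdepth g).+1
  end
with pdepth (A : Type) (g : pform A) : nat :=
  match g with
  | PState f => sdepth f
  | PNeg g1 => pdepth g1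
  | PAnd g1 g2 | PUntil g1 g2 => maxn (pdepth g1) (pdepth g2)
  end.

Fixpoint ssubst (A B : Type) (h : A -> B) (f : sform A) : sform B :=
  match f with
  | STrue => STrue
  | SAtom a => SAtom (h a)
  | SNeg f1 => SNeg (ssubst h f1)
  | SAnd f1 f2 => SAnd (ssubst h f1) (ssubst h f2)
  | SEx g => SEx (psubst h g)
  end
with psubst (A B : Type) (h : A -> B) (g : pform A) : pform B :=
  match g with
  | PState f => PState (ssubst h f)
  | PNeg g1 => PNeg (psubst h g1)
  | PAnd g1 g2 => PAnd (psubst h g1) (psubst h g2)
  | PUntil g1 g2 => PUntil (psubst h g1) (psubst h g2)
  end.

Section Satisfaction.
Variables (A : choiceType) (L Q : Type) (M : lts A L Q).

Definition deadlock (q : Q) : Prop := ~ exists a q', step M q a q'.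

(* Maximal paths: the infinite ones, and the finite ones that end in a deadlock,
   whose last state is then repeated forever. The latter occur in token-passing
   systems when the token reaches a vertex without out-neighbours; repetition of
   the last state is invisible to formulas without X. *)
Definition is_path (p : nat -> Q) : Prop :=
  forall i, (exists a, step M (p i) a (p i.+1)) \/
            (deadlock (p i) /\ p i.+1 = p i).

Definition suffix_from (i : nat) (p : nat -> Q) : nat -> Q :=
  fun j => p (i + j).

Fixpoint ssat (q : Q) (f : sform A) : Prop :=
  match f with
  | STrue => True
  | SAtom a => a \in label M q
  | SNeg f1 => ~ ssat q f1
  | SAnd f1 f2 => ssat q f1 /\ ssat q f2
  | SEx g => exists p, [/\ is_path p, p 0 = q & psat p g]
  end
with psat (p : nat -> Q) (g : pform A) : Prop :=
  match g with
  | PState f => ssat (p 0) f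
  | PNeg g1 => ~ psat p g1
  | PAnd g1 g2 => psat p g1 /\ psat p g2
  | PUntil g1 g2 =>
      exists j, psat (suffix_from j p) g2 /\
                forall i, i < j -> psat (suffix_from i p) g1
  end.

Definition lts_sat (f : sform A) : Prop := forall q, init M q -> ssat q f.

End Satisfaction.

Inductive quantifier := Forall | Exists.

(* The range of an index quantifier in the scope of the variables x_0, ...,
   x_(n-1). *)
Inductive range (n : nat) :=
  | RAll
  | RIn of {set 'I_n}
  | RSucc of 'I_n.

(* [iform AP r n]: formulas with r index quantifiers, in the scope of n already
   quantified index variables x_0, ..., x_(n-1); the outermost quantifier binds
   x_n. The k-indexed formulas (sentences) are those of type [iform AP k 0]. *)
Inductive iform (AP : Type) : nat -> nat -> Type :=
  | IBody n of sform (AP * 'I_n) : iform AP 0 n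
  | IQuant r n of quantifier & range n & iform AP r n.+1 : iform AP r.+1 n.

Fixpoint idepth (AP : Type) (r n : nat) (phi : iform AP r n) : nat :=
  match phi with
  | IBody _ f => sdepth f
  | IQuant _ _ _ _ psi => idepth psi
  end.

Definition in_range (G : topology) (n : nat) (g : n.-tuple (vertex G))
    (R : range n) (v : vertex G) : bool :=
  match R with
  | RAll => true
  | RIn Y => v \in [set tnth g y | y in Y]
  | RSucc y => (tnth g y, v) \in edges G
  end.

(* The tuple g lists the vertices denoted by the variables in scope. *)
Fixpoint isat_at (AP : choiceType) (Sint : Type) (P : template AP Sint)
    (G : topology) (r n : nat) (phi : iform AP r n) :
    n.-tuple (vertex G) -> Prop :=
  match phi with
  | IBody _ f => fun g =>
      lts_sat (system P G) (ssubst (fun a => (a.1, tnth g a.2)) f)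
  | IQuant _ _ Forall R psi => fun g =>
      forall v, in_range g R v -> isat_at P psi (rcons_tuple g v)
  | IQuant _ _ Exists R psi => fun g =>
      exists v, in_range g R v /\ isat_at P psi (rcons_tuple g v)
  end.

Definition isat (AP : choiceType) (Sint : Type) (P : template AP Sint)
    (G : topology) (k : nat) (phi : iform AP k 0) : Prop :=
  @isat_at AP Sint P G k 0 phi [tuple].

(* Main.v *)
Require Import Defs.
From mathcomp Require Import all_boot finmap boolp zify.

Set Implicit Arguments.
Unset Strict Implicit.
Unset Printing Implicit Defensive.

(* Fix the vertices g_1, ..., g_k that a formula observes. A vertex has a type of
   level d: at level 0 it is the set of indices i with g_i = v, and at level d+1
   it also records, for v and for every g_i, the stutter-free words of types of
   level d that the token may read on its way to the next g_j. Away from the g_j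
   the types can only decrease along an edge, so these words are bounded and there
   are finitely many types of each level, uniformly in the topology.

   Processes cannot take internal steps forever, so an unobserved process can
   always be brought to a state where it is ready to pass on or receive the token.
   Hence two system states that agree on the observed processes and on the type of
   level d+1 of the token have, up to stuttering, the same paths at level d, and
   satisfy the same CTL*\X formulas of depth d+1. The truth of an indexed formula
   in a topology therefore only depends on a finite profile, and the cutoff is the
   largest size in a choice of one topology for each realized profile. *)

(** * Types of token positions *)

Section TokenTrace.
Variables (k : nat) (G : topology) (g : 'I_k -> vertex G).

Definition pos (v : vertex G) : {set 'I_k} := [set i | g i == v].

Lemma pos_inj u v : pos u = pos v -> pos u != set0 -> u = v.
Proof.
move=> e /set0Pn[i iu]; have : i \in pos v by rewrite -e.
by move: iu; rewrite !inE => /eqP <- /eqP.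
Qed.

Definition edge (u v : vertex G) := (u, v) \in edges G.

Lemma edge_neq u v : edge u v -> u != v.
Proof.
by move=> uv; apply/eqP => e; move/forallP/(_ u): (no_loop G); rewrite {2}e -/(edge u v) uv.
Qed.

(** The second clause lets the token rest forever only at a vertex without out-neighbours, as on
    maximal paths of the system. *)
Definition token_path (tau : nat -> vertex G) : Prop :=
  (forall n, tau n.+1 = tau n \/ edge (tau n) (tau n.+1)) /\
  (forall n, (forall m, n <= m -> tau m = tau n) -> forall w, ~~ edge (tau n) w).

Definition ev_const (tau : nat -> vertex G) : Prop :=
  exists n, forall m, n <= m -> tau m = tau n.

Definition ending := ({set 'I_k} + bool)%type.

Section Fit.
Variables (C : eqType) (c : vertex G -> C).

(* [fit tau n l e]: until the first time after n at which tau enters a vertex of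
   g from elsewhere, tau visits the c-classes listed in l, consecutive
   repetitions being dropped. If there is such a time then e is [inl] of the
   indices of that vertex; otherwise the class is eventually constant and e
   tells whether tau gets stuck. *)
Inductive fit (tau : nat -> vertex G) (n : nat) : seq C -> ending -> Prop :=
  | fit_end (b : bool) : (forall m, n <= m -> c (tau m) = c (tau n)) ->
      (b <-> ev_const tau) -> fit tau n [:: c (tau n)] (inr b)
  | fit_exit : c (tau n.+1) != c (tau n) -> pos (tau n.+1) != set0 ->
      fit tau n [:: c (tau n)] (inl (pos (tau n.+1)))
  | fit_stay l e : c (tau n.+1) = c (tau n) -> fit tau n.+1 l e -> fit tau n l e
  | fit_move l e : c (tau n.+1) != c (tau n) -> pos (tau n.+1) = set0 ->
      fit tau n.+1 l e -> fit tau n (c (tau n) :: l) e.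

Lemma fitS tau n l e : fit tau n l e ->
  [\/ c (tau n.+1) = c (tau n) /\ fit tau n.+1 l e,
      [/\ c (tau n.+1) != c (tau n), pos (tau n.+1) != set0,
          l = [:: c (tau n)] & e = inl (pos (tau n.+1))] |
      [/\ c (tau n.+1) != c (tau n), pos (tau n.+1) = set0 &
          exists2 l', l = c (tau n) :: l' & fit tau n.+1 l' e]].
Proof.
case=> [b cst bE|neq p|l' e' eq f|l' e' neq p f].
- constructor 1; split; first exact: cst.
  rewrite -(cst n.+1) //; apply: fit_end => // m nm.
  by rewrite !cst // ltnW.
- by constructor 2.
- by constructor 1.
- by constructor 3; split=> //; exists l'.
Qed.

Lemma fit_const tau n m l e : (forall i, n <= i <= m -> c (tau i) = c (tau n)) ->
  n <= m -> fit tau n l e -> fit tau m l e.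
Proof.
move=> cst nm f; elim: m nm cst => [|m IH]; first by rewrite leqn0 => /eqP <-.
rewrite leq_eqVlt => /orP[/eqP <- //|nm] cst.
have {}f : fit tau m l e.
  by apply: IH => // i /andP[ni im]; apply: cst; rewrite ni leqW.
have eq : c (tau m.+1) = c (tau m) by rewrite !cst ?leqnn ?leqnSn ?andbT // ltnW.
by case/fitS: f => [[]//|[]|[]]; rewrite eq eqxx.
Qed.

Lemma fit_head tau n l e : fit tau n l e -> exists l', l = c (tau n) :: l'.
Proof.
elim=> {n l e} [n b _ _|n _ _|n l e -> _ //|n l e _ _ _ _].
- by exists [::].
- by exists [::].
- by exists l.
Qed.

Lemma ev_const_shift tau tau' n n' :
  (forall i, tau' (n' + i) = tau (n + i)) -> ev_const tau -> ev_const tau'.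
Proof.
move=> E [N cN]; exists (n' + N) => m hm.
have -> : m = n' + (m - n') by lia.
by rewrite !E cN ?[in RHS]cN //; lia.
Qed.

Lemma fit_shift tau tau' n n' l e :
  (forall i, tau' (n' + i) = tau (n + i)) -> fit tau n l e -> fit tau' n' l e.
Proof.
move=> E f; elim: f n' E => {n l e} [n b cst bE|n neq p|n l e eq _ IH|n l e neq p _ IH] n' E.
- have := E 0; rewrite !addn0 => E0; rewrite -E0; apply: fit_end => [m hm|].
    have -> : m = n' + (m - n') by lia.
    by rewrite E E0 cst // leq_addr.
  rewrite bE; split; [exact: ev_const_shift E|].
  by apply: (@ev_const_shift _ _ n' n) => i; rewrite E.
- have := E 0; have := E 1; rewrite !addn1 !addn0 => E1 E0.
  by rewrite -E0 -E1; apply: fit_exit; rewrite ?E1 ?E0.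
- have := E 0; have := E 1; rewrite !addn1 !addn0 => E1 E0.
  apply: fit_stay; first by rewrite E0 E1.
  by apply: IH => i; rewrite !addSnnS.
- have := E 0; have := E 1; rewrite !addn1 !addn0 => E1 E0.
  rewrite -E0; apply: fit_move; rewrite ?E0 ?E1 //.
  by apply: IH => i; rewrite !addSnnS.
Qed.

Lemma fit_const_end tau n l e : (forall m, n <= m -> c (tau m) = c (tau n)) ->
  fit tau n l e ->
  l = [:: c (tau n)] /\ exists2 b : bool, e = inr b & (b <-> ev_const tau).
Proof.
move=> cst f; elim: f cst => {n l e} [n b _ bE|n neq _|n l e eq _ IH|n l e neq _ _ _] cst.
- by split=> //; exists b.
- by rewrite cst ?eqxx in neq.
- by rewrite -eq; apply: IH => m nm; rewrite !cst // ltnW.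
- by rewrite cst ?eqxx in neq.
Qed.

Lemma fit_inr tau n t (b : bool) : fit tau n [:: t] (inr b) ->
  (forall m, n <= m -> c (tau m) = c (tau n)) /\ (b <-> ev_const tau).
Proof.
move El : [:: t] => l; move Ee : (inr b) => e f.
elim: f El Ee => {n l e} [n b' cst bE|n _ _ _|n l e eq _ IH|n l e _ _ f _] //.
- by move=> _ [->].
- move=> El Ee; have [cst bE] := IH El Ee; split=> // m.
  by rewrite leq_eqVlt => /orP[/eqP ->//|/cst ->].
- by case: (fit_head f) => l' ->.
Qed.

Variable rk : C -> nat.
Hypothesis rk_edge : forall u w, edge u w -> pos w = set0 ->
  c w = c u \/ rk (c w) < rk (c u).

(** Induction on the rank of the current class, which drops at each [fit_move] by [rk_edge]. *)
Lemma fit_exists tau n : token_path tau -> exists l e, fit tau n l e.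
Proof.
move=> [tp _].
have [r] := ubnP (rk (c (tau n))); elim: r n => // r IH n.
have [cst _|] := pselect (forall m, n <= m -> c (tau m) = c (tau n)).
  exists [:: c (tau n)], (inr `[< ev_const tau >]); apply: fit_end => //.
  by split => [/asboolP|/asboolP].
move=> /existsNP[m /not_implyP[nm]].
(* [i] is the distance to some later time of another class; induction on it passes over the times of
   constant class. *)
rewrite -(subnKC nm); move: (m - n) => i {m nm}.
elim: i n => [|i IHi] n; first by rewrite addn0.
rewrite addnS -addSn => neq rkn.
have [eq|neq1] := eqVneq (c (tau n.+1)) (c (tau n)).
  have [||l [e f]] := IHi n.+1; rewrite ?eq //.
  by exists l, e; apply: fit_stay.
have [p|p] := eqVneq (pos (tau n.+1)) set0; last first.
  by exists [:: c (tau n)], (inl (pos (tau n.+1))); apply: fit_exit.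
have [|l [e f]] := IH n.+1; last first.
  by exists (c (tau n) :: l), e; apply: fit_move.
case: (tp n) => [eq|ed]; first by rewrite eq eqxx in neq1.
by case: (rk_edge ed p) => [eq|]; [rewrite eq eqxx in neq1|lia].
Qed.

Lemma fit_uniq tau n l e : token_path tau -> fit tau n l e -> uniq l.
Proof.
move=> [tp _] f; suff: sorted (fun x y => rk y < rk x) l.
  apply: sorted_uniq => [x y z /= xy yz|x]; last by rewrite /= ltnn.
  exact: ltn_trans yz xy.
elim: f => // {n l e} n l e neq p f.
case: (fit_head f) => l' -> /= ->; rewrite andbT.
case: (tp n) => [eq|ed]; first by rewrite eq eqxx in neq.
by case: (rk_edge ed p) => // eq; rewrite eq eqxx in neq.
Qed.

End Fit.
End TokenTrace.

(** * The hierarchy of vertex types *)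

Section Types.
Variable k : nat.

Local Notation seg_type T := (#|T|.-bseq T * ending k)%type.

Fixpoint vtype (d : nat) : finType :=
  match d with
  | 0 => {set 'I_k}
  | d'.+1 => (vtype d' * {ffun option 'I_k -> {set seg_type (vtype d')}})%type
  end.

(* Along an edge that does not enter g the set of segments can only shrink, so
   the rank decreases as soon as the type changes. Hence the words of [fit] have
   no repetition, which is why [vtype] only needs words of bounded length. *)
Fixpoint rank (d : nat) : vtype d -> nat :=
  match d return vtype d -> nat with
  | 0 => fun t => t != set0
  | d'.+1 => fun t => rank t.1 * #|{: seg_type (vtype d')}|.+1 + #|t.2 None|
  end.

Section Graph.
Variables (G : topology) (g : 'I_k -> vertex G).

Definition segments (T : finType) (c : vertex G -> T) (v : vertex G) :
    {set seg_type T} :=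
  [set x : seg_type T | `[< exists tau n, [/\ token_path tau, tau n = v &
                                 fit g c tau n x.1 x.2] >]].

(* The index [None] stands for the vertex v itself and [Some i] for g i. *)
Fixpoint ty (d : nat) : vertex G -> vtype d :=
  match d return vertex G -> vtype d with
  | 0 => pos g
  | d'.+1 => fun v => (ty d' v, [ffun o => segments (ty d') (oapp g v o)])
  end.

End Graph.

Lemma ty_pos G H (g : 'I_k -> vertex G) (h : 'I_k -> vertex H) d u v :
  ty g d u = ty h d v -> pos g u = pos h v.
Proof. by elim: d => //= d IH [/IH]. Qed.

Section Edges.
Variables (G : topology) (g : 'I_k -> vertex G).
Notation segments := (segments g).
Notation ty := (ty g).

(** Prepending [u] to a token path from [w] only adds a [fit_stay], since both vertices have the
    same class. *)
Lemma segments_edge (T : finType) (c : vertex G -> T) u w :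
  edge u w -> c w = c u -> segments c w \subset segments c u.
Proof.
move=> uw cE; apply/subsetP => x; rewrite !inE => /asboolP[tau [n [tp tn f]]].
apply/asboolP; exists (fun i => if i is i'.+1 then tau (n + i') else u), 0.
split=> //.
  case: tp => tp1 tp2; split.
    case=> [|i]; first by right; rewrite addn0 tn.
    by rewrite addnS; apply: tp1.
  case=> [/(_ 1 isT) eq|i cst].
    by move: (edge_neq uw); rewrite -eq addn0 tn eqxx.
  apply: tp2 => m hm; have := cst (m - n).+1; rewrite subnKC; last by lia.
  by apply; lia.
apply: fit_stay; first by rewrite addn0 tn.
by apply: fit_shift f => i; rewrite add1n.
Qed.

(** If the lower type changes, the factor in [rank] makes its drop outweigh any growth of the
    segment set. Otherwise only the [None] component can differ, because the components at [Some i]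
    do not depend on the vertex. *)
Lemma rank_edge d u w : edge u w -> pos g w = set0 ->
  ty d w = ty d u \/ rank (ty d w) < rank (ty d u).
Proof.
move=> uw pw; elim: d => /= [|d].
  by rewrite pw eqxx /=; have [->|] := eqVneq (pos g u) set0; [left|right].
rewrite !ffunE /=; case=> [eq|lt]; last first.
  right; have := max_card (mem (segments (ty d) w)).
  move: lt; set a := rank _; set b := rank _; set x := #|_|; set z := #|_|.
  by set t := #|_|; nia.
have := segments_edge uw eq; rewrite subEproper => /orP[/eqP sE|sP].
  left; rewrite eq; congr pair; apply/ffunP => -[i|]; rewrite !ffunE //=.
by right; rewrite eq ltn_add2l; apply: proper_card.
Qed.

Lemma segments_exist d tau n : token_path tau ->
  exists x : seg_type (vtype d), fit g (ty d) tau n x.1 x.2.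
Proof.
move=> tp; have [l [e f]] := fit_exists (@rank_edge d) n tp.
have sl : size l <= #|vtype d|.
  have /card_uniqP <- := fit_uniq (@rank_edge d) tp f; exact: max_card.
by exists (Bseq sl, e).
Qed.

(** Equal types give equal sets [pos]; a nonempty one would determine the vertex and make the edge a
    loop. *)
Lemma same_ty_edge d u w : edge u w -> ty d w = ty d u ->
  pos g u = set0 /\ pos g w = set0.
Proof.
move=> uw /ty_pos e; have [p|p] := eqVneq (pos g w) set0; first by rewrite -e.
by have := pos_inj e p => E; move: (edge_neq uw); rewrite E eqxx.
Qed.

End Edges.
End Types.

(** * Token-passing systems *)

Section Process.
Variables (AP : choiceType) (Sint : Type) (P : template AP Sint).

Definition intern (q q' : tstate P) : bool :=
  `[< exists a, step P q (Internal a) q' >].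

Definition settled (q : tstate P) : Prop := forall q', ~~ intern q q'.

Lemma omega_block_internal (a b : action Sint) (u : nat -> action Sint) :
  (if a is Internal _ then false else true) ->
  (forall i, exists c, u i = Internal c) -> ~ omega_power (block a b) u.
Proof.
move=> ha hu [cut [_ _ /(_ 0) [x [y e]]]].
pose is_int (c : action Sint) := if c is Internal _ then true else false : bool.
have : all is_int [seq u j | j <- iota (cut 0) (cut 1 - cut 0)].
  by rewrite all_map; apply/allP => j _ /=; case: (hu j) => c ->.
by rewrite e all_cat /=; case: a ha e => //=; rewrite andbF.
Qed.

(** Otherwise iterating a choice of internal successors inside [X] yields an infinite path of
    internal actions, against [alternateP]. *)
Lemma intern_exit (X : {set tstate P}) x : x \in X ->
  exists2 y, y \in X & forall z, z \in X -> ~~ intern y z.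
Proof.
move=> xX; apply: contrapT => H.
have {}H y : y \in X -> exists2 z, z \in X & intern y z.
  move=> yX; apply: contrapT => Hy; apply: H; exists y => // z zX.
  by apply/negP => yz; apply: Hy; exists z.
pose f y := odflt y [pick z in X | intern y z].
have fP y : y \in X -> (f y \in X) && intern y (f y).
  move=> yX; rewrite /f; case: pickP => [z //|none].
  by case: (H y yX) => z zX yz; move: (none z); rewrite zX yz.
pose q i := iter i f x.
have qX i : q i \in X by elim: i => //= i /fP /andP[].
have /choice[a qa] i : exists a, step P (q i) (Internal a) (q i.+1).
  by have /andP[_ /asboolP] := fP _ (qX i).
have ai i : exists c, Internal (a i) = Internal c by exists (a i).
by case: (@alternateP _ _ P q (fun i => Internal (a i)) qa); apply: omega_block_internal.
Qed.

(** Counts the states reachable by at least one internal step; this is a termination measure, as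
    internal steps form no cycle. *)
Definition height (q : tstate P) : nat :=
  #|[set y | [exists z, intern q z && connect intern z y]]|.

Lemma height_intern q q' : intern q q' -> height q' < height q.
Proof.
move=> qq'; apply: proper_card; apply/properP; split.
  apply/subsetP => y; rewrite !inE => /existsP[z /andP[q'z zy]].
  by apply/existsP; exists q'; rewrite qq' (connect_trans (connect1 q'z)).
exists q'; rewrite inE; first by apply/existsP; exists q'; rewrite qq' /=.
apply/negP => /existsP[z /andP[q'z zq']].
(* The strongly connected component of [q']. If [q'] lay on an internal cycle, each of its states
   would have a successor inside, against [intern_exit]. *)
pose X := [set y | connect intern q' y && connect intern y q'].
have [|y] := @intern_exit X q'; first by rewrite inE connect0.
rewrite inE => /andP[q'y /connectP[r]]; case: r => [_ /= e|t r /= /andP[yt tr] e] H.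
  by move: (H z); rewrite -e q'z inE zq' connect1 // => /(_ isT).
move: (H t); rewrite yt inE (connect_trans q'y (connect1 yt)).
suff -> : connect intern t q' by move/(_ isT).
by apply/connectP; exists r.
Qed.

Lemma settled_snd q : settled q -> q \in holds P -> exists q', step P q Snd q'.
Proof.
move=> sq qT; case: (totalP q) => -[b||] [q' qq'].
- by move: (sq q') => /asboolPn; case; exists b.
- by exists q'.
- by case: (rcvP qq'); rewrite qT.
Qed.

Lemma settled_rcv q : settled q -> q \notin holds P -> exists q', step P q Rcv q'.
Proof.
move=> sq qT; case: (totalP q) => -[b||] [q' qq'].
- by move: (sq q') => /asboolPn; case; exists b.
- by case: (sndP qq'); rewrite (negPf qT).
- by exists q'.
Qed.

End Process.

Section TokenSystem.
Variables (AP : choiceType) (Sint : Type) (P : template AP Sint) (G : topology).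
Notation state := (sys_state P G).
Implicit Types (s : state) (u v w x : vertex G).

Definition carries s v : Prop := forall u, (s u \in holds P) = (u == v).

Lemma init_carries s : sys_init s -> carries s (start G).
Proof.
by move=> -> u; rewrite ffunE; case: eqP; rewrite ?iota_tP // (negPf (iota_nP P)).
Qed.

Definition tok s : vertex G := odflt (start G) [pick u | s u \in holds P].

Lemma tokE s v : carries s v -> tok s = v.
Proof.
move=> sv; rewrite /tok; case: pickP => [u|/(_ v)]; rewrite sv ?eqxx //.
by move/eqP.
Qed.

Definition upd s x q : state := [ffun u => if u == x then q else s u].

Lemma internal_step s v x q : carries s v -> intern (s x) q ->
  (exists a, sys_step s a (upd s x q)) /\ carries (upd s x q) v.
Proof.
move=> sv /asboolP[a sq]; split.
  exists (SysInternal a), x; split; first by rewrite ffunE eqxx.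
  by move=> u /negPf ux; rewrite ffunE ux.
move=> u; rewrite ffunE; case: eqP => [->|_]; last exact: sv.
by rewrite -(internalP sq) sv.
Qed.

Lemma tok_step s v w q1 q2 : carries s v -> edge v w ->
  step P (s v) Snd q1 -> step P (s w) Rcv q2 ->
  sys_step s Tok (upd (upd s v q1) w q2) /\ carries (upd (upd s v q1) w q2) w.
Proof.
move=> sv vw h1 h2; have /negPf nvw := edge_neq vw; split.
  exists v, w; split=> //; rewrite ?ffunE ?eqxx ?nvw //.
  by move=> u /negPf uv /negPf uw; rewrite !ffunE uv uw.
move=> u; rewrite !ffunE; case: eqP => [_|_]; first by case: (rcvP h2).
case: eqP => [_|/eqP uv]; first by case: (sndP h1) => _ /negPf.
by rewrite sv (negPf uv).
Qed.

Lemma step_inv s v a s' : carries s v -> sys_step s a s' ->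
  (exists x b, [/\ step P (s x) (Internal b) (s' x),
                   forall u, u != x -> s' u = s u & carries s' v]) \/
  (exists w, [/\ edge v w, step P (s v) Snd (s' v), step P (s w) Rcv (s' w),
                 forall u, u != v -> u != w -> s' u = s u & carries s' w]).
Proof.
move=> sv; case: a => [b [x [sx eqs]]|[v' [w [vw h1 h2 eqs]]]].
  left; exists x, b; split=> // u; have [->|ux] := eqVneq u x.
    by rewrite -(internalP sx) sv.
  by rewrite eqs // sv.
have e : v' = v by apply/eqP; rewrite -sv; case: (sndP h1).
rewrite {v'}e in vw h1 eqs *; right; exists w; split=> // u.
have [->|uw] := eqVneq u w; first by case: (rcvP h2).
have [->|uv] := eqVneq u v; first by case: (sndP h1) => _ /negPf.
by rewrite eqs // sv (negPf uv).
Qed.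

Lemma deadlock_settled s x : deadlock (system P G) s -> settled (s x).
Proof.
move=> dl q; apply/asboolPn => -[b sq]; apply: dl.
exists (SysInternal b), (upd s x q), x; rewrite ffunE eqxx; split=> //.
by move=> u /negPf ux; rewrite ffunE ux.
Qed.

Lemma deadlock_edge s v w : carries s v -> deadlock (system P G) s -> ~~ edge v w.
Proof.
move=> sv dl; apply/negP => vw.
have [q1 h1] : exists q', step P (s v) Snd q'.
  by apply: settled_snd; [exact: deadlock_settled|rewrite sv].
have [q2 h2] : exists q', step P (s w) Rcv q'.
  apply: settled_rcv; first exact: deadlock_settled.
  by rewrite sv eq_sym edge_neq.
by apply: dl; exists Tok, (upd (upd s v q1) w q2); apply: (tok_step sv vw h1 h2).1.
Qed.

Definition max_step s s' : Prop :=
  (exists a, step (system P G) s a s') \/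
  (deadlock (system P G) s /\ s' = s).

Section Path.
Variables (p : nat -> state) (pP : is_path (system P G) p).
Variables (v0 : vertex G) (p0 : carries (p 0) v0).

Lemma path_carries n : carries (p n) (tok (p n)).
Proof.
suff [v pv] : exists v, carries (p n) v by rewrite (tokE pv).
elim: n => [|n [v pv]]; first by exists v0.
case: (pP n) => [[a /(step_inv pv)]|[_ ->]]; last by exists v.
by case=> [[x [b [_ _ pv']]]|[w [_ _ _ _ pv']]]; [exists v|exists w].
Qed.

(** While the token does not move only internal steps occur, and each lowers the sum of the heights
    of all processes. *)
Lemma stuck_deadlock n : (forall m, n <= m -> tok (p m) = tok (p n)) ->
  exists2 m, n <= m & deadlock (system P G) (p m).
Proof.
have [r] := ubnP (\sum_u height (p n u)); elim: r n => // r IH n lt cst.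
case: (pP n) => [[a st]|[dl _]]; last by exists n.
case: (step_inv (path_carries n) st) => [[x [b [sx eqs _]]]|[w [vw _ _ _ pw]]].
  have [||m nm dl] := IH n.+1.
  - rewrite -ltnS; apply: leq_trans lt; rewrite ltnS (bigD1 x) //= [X in _ < X](bigD1 x) //=.
    rewrite (eq_bigr (fun u => height (p n u))) => [|u ux]; last by rewrite eqs.
    by rewrite ltn_add2r height_intern //; apply/asboolP; exists b.
  - by move=> m nm; rewrite !cst // ltnW.
  - by exists m => //; apply: ltnW.
by move: (edge_neq vw); rewrite -(cst n.+1) // (tokE pw) eqxx.
Qed.

Lemma tok_path : token_path (tok \o p).
Proof.
split=> /= [n|n cst w].
  case: (pP n) => [[a /(step_inv (path_carries n))]|[_ ->]]; last by left.
  by case=> [[x [b [_ _ /tokE ->]]]|[w [vw _ _ _ /tokE ->]]]; [left|right].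
have [m nm dl] := stuck_deadlock cst.
by rewrite -(cst m nm); apply: deadlock_edge dl; apply: path_carries.
Qed.

End Path.

(* All states but the last are in C. *)
Inductive run (C : state -> Prop) : nat -> state -> state -> Prop :=
  | run0 s : run C 0 s s
  | runS n s s1 s2 : C s -> max_step s s1 -> run C n s1 s2 -> run C n.+1 s s2.

Lemma run_cat C n m s1 s2 s3 :
  run C n s1 s2 -> run C m s2 s3 -> run C (n + m) s1 s3.
Proof. by elim=> // {n s1 s2} n s s1 s2 Cs ss1 _ IH /IH; apply: runS. Qed.

Section Observed.
Variables (k : nat) (g : 'I_k -> vertex G).

Definition gst s : {ffun 'I_k -> tstate P} := [ffun i => s (g i)].

Lemma gst_upd s x q : pos g x = set0 -> gst (upd s x q) = gst s.
Proof.
move=> px; apply/ffunP => i; rewrite !ffunE; case: eqP => // e.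
by move/setP/(_ i): px; rewrite !inE e eqxx.
Qed.

(** The run consists of internal steps of the unobserved process [x], so [C] persists along it; it
    ends because [height] decreases. *)
Lemma settle (C : state -> Prop) s v x :
  (forall s1, carries s1 v -> gst s1 = gst s -> C s1) ->
  carries s v -> pos g x = set0 ->
  exists n s1, [/\ run C n s s1, carries s1 v, settled (s1 x) &
                   forall u, u != x -> s1 u = s u].
Proof.
have [r] := ubnP (height (s x)); elim: r s => // r IH s lt HC sv px.
have [st|] := pselect (settled (s x)).
  by exists 0, s; split=> //; apply: run0.
move=> /existsNP[q /negP]; rewrite negbK => xq.
have [[a sa] uv] := internal_step sv xq.
have [|s2 s2v s2g|||n [s1 [rn s1v st eqs]]] := IH (upd s x q) => //.
- by rewrite ffunE eqxx -ltnS; apply: leq_trans lt; rewrite ltnS height_intern.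
- by apply: HC => //; rewrite s2g gst_upd.
exists n.+1, s1; split=> //.
  by apply: runS rn; [apply: HC|left; exists a].
by move=> u ux; rewrite eqs // ffunE (negPf ux).
Qed.

Lemma gst_eq s s' x : pos g x = set0 -> (forall u, u != x -> s' u = s u) ->
  gst s' = gst s.
Proof.
move=> px eqs; apply/ffunP => i; rewrite !ffunE eqs //; apply/eqP => e.
by move/setP/(_ i): px; rewrite !inE e eqxx.
Qed.

(** An observed end of the edge takes the prescribed step to [q1] or [q2]; an unobserved end is
    first settled, after which some [Snd] or [Rcv] step is available. *)
Lemma tok_move (C : state -> Prop) s v w q1 q2 :
  (forall s1, carries s1 v -> gst s1 = gst s -> C s1) ->
  carries s v -> edge v w ->
  (pos g v != set0 -> step P (s v) Snd q1) ->
  (pos g w != set0 -> step P (s w) Rcv q2) ->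
  exists n s2, [/\ run C n.+1 s s2, carries s2 w,
    pos g v != set0 -> s2 v = q1, pos g w != set0 -> s2 w = q2 &
    forall u, u != v -> u != w -> s2 u = s u].
Proof.
move=> HC sv vw h1 h2; have nvw := edge_neq vw.
have [n1 [s1 [r1 s1v g1 [r1' t1 h1'] [s1w eq1]]]] : exists n1 s1,
  [/\ run C n1 s s1, carries s1 v, gst s1 = gst s,
      exists2 q, step P (s1 v) Snd q & (pos g v != set0 -> q = q1) &
      (s1 w = s w) /\ forall u, u != v -> s1 u = s u].
  have [pv|pv] := eqVneq (pos g v) set0; last first.
    exists 0, s; split=> //; first exact: run0.
    by exists q1 => //; apply: h1.
  have [n [s1 [rn s1v st eqs]]] := settle HC sv pv.
  have [q sq] : exists q, step P (s1 v) Snd q.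
    by apply: settled_snd => //; rewrite s1v.
  exists n, s1; split=> //; first exact: gst_eq pv eqs.
    by exists q => //; rewrite pv eqxx.
  by split=> //; apply: eqs; rewrite eq_sym.
have HC1 : forall s2, carries s2 v -> gst s2 = gst s1 -> C s2.
  by move=> s2 s2v; rewrite g1; apply: HC.
have [n2 [s2 [r2 s2v g2 [r2' t2 h2'] eq2]]] : exists n2 s2,
  [/\ run C n2 s1 s2, carries s2 v, gst s2 = gst s1,
      exists2 q, step P (s2 w) Rcv q & (pos g w != set0 -> q = q2) &
      forall u, u != w -> s2 u = s1 u].
  have [pw|pw] := eqVneq (pos g w) set0; last first.
    exists 0, s1; split=> //; first exact: run0.
    by exists q2 => //; rewrite s1w; apply: h2.
  have [n [s2 [rn s2v st eqs]]] := settle HC1 s1v pw.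
  have [q sq] : exists q, step P (s2 w) Rcv q.
    by apply: settled_rcv => //; rewrite s2v eq_sym.
  exists n, s2; split=> //; first exact: gst_eq pw eqs.
  by exists q => //; rewrite pw eqxx.
have [] := @tok_step s2 v w r1' r2' s2v vw.
- by rewrite eq2.
- by [].
move=> st s3w; exists (n1 + n2), (upd (upd s2 v r1') w r2'); split=> //.
- rewrite -addn1; apply: (@run_cat _ _ _ _ s2); first exact: run_cat r1 r2.
  apply: runS; [|by left; exists Tok; apply: st|exact: run0].
  by apply: HC1.
- by move=> pv; rewrite !ffunE (negPf nvw) eqxx; auto.
- by move=> pw; rewrite !ffunE eqxx; auto.
- by move=> u uv uw; rewrite !ffunE (negPf uv) (negPf uw) eq2 // eq1.
Qed.

End Observed.
End TokenSystem.

(** * Stuttering simulation *)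

Section Stutter.
Variables (Q Q' : Type) (R : Q -> Q' -> Prop).

(* The state p' j is related to the block of states of p from time a j up to time
   a j.+1 (excluded), or to the single state p (a j) when a does not move. *)
Definition stutter (p : nat -> Q) (p' : nat -> Q') : Prop :=
  exists a : nat -> nat, [/\ a 0 = 0, forall j, a j <= a j.+1,
    forall n, exists j, n <= a j &
    forall i j, a j <= i -> i < a j.+1 \/ i = a j -> R (p i) (p' j)].

Lemma nondecreasing_leq (a : nat -> nat) : (forall j, a j <= a j.+1) ->
  forall i j, i <= j -> a i <= a j.
Proof.
by move=> mono i j /subnKC <-; elim: (j - i) => [|r IH];
   rewrite ?addn0 // addnS (leq_trans IH).
Qed.

Lemma stutter_suffix (a : nat -> nat) p p' i j :
  (forall j, a j <= a j.+1) -> (forall n, exists j, n <= a j) ->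
  (forall i j, a j <= i -> i < a j.+1 \/ i = a j -> R (p i) (p' j)) ->
  a j <= i -> i < a j.+1 \/ i = a j ->
  stutter (suffix_from i p) (suffix_from j p').
Proof.
move=> mono unb aR aji ij; exists (fun x => a (j + x) - i).
have mono' := nondecreasing_leq mono.
split=> [|x|n|i0 x].
- by rewrite addn0; apply/eqP.
- by rewrite addnS leq_sub2r.
- have [j' nj'] := unb (n + i); exists j'.
  by have := mono' j' (j + j') (leq_addl _ _); lia.
move=> /= h1 h2; apply: aR; first by lia.
case: x h1 h2 => [|x]; first by rewrite addn0 addn1 => h1 h2; lia.
have : a j.+1 <= a (j + x).+1 by apply: mono'; lia.
by have := mono j; rewrite !addnS => *; lia.
Qed.

(** [j] is the least block containing [i]. By minimality the earlier blocks begin strictly before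
    [i], as the left argument of [PUntil] requires. *)
Lemma stutter_index (a : nat -> nat) i : a 0 = 0 ->
  (forall j, a j <= a j.+1) -> (forall n, exists j, n <= a j) ->
  exists j, [/\ a j <= i, i < a j.+1 \/ i = a j & forall j', j' < j -> a j' < i].
Proof.
move=> a0 mono unb; have mono' := nondecreasing_leq mono.
have ex : exists j, (i < a j.+1) || (i == a j).
  have [j] := unb i.+1; case: j => [|j]; first by rewrite a0.
  by move=> lt; exists j; rewrite lt.
have [j jP jmin] := ex_minnP ex.
have lt j' : j' < j -> a j' < i.
  elim: j' => [|j' IH] j'j; rewrite ltnNge; apply/negP => le; move: (jmin).
    move/(_ 0); rewrite a0 in le *; move: le; rewrite leqn0 => /eqP -> .
    by rewrite eqxx orbT => /(_ isT); rewrite leqNgt j'j.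
  have := IH (ltnW j'j) => lt'.
  have [e|ne] := eqVneq i (a j'.+1).
    by move/(_ j'.+1); rewrite e eqxx orbT => /(_ isT); rewrite leqNgt j'j.
  have lt2 : i < a j'.+1 by rewrite ltn_neqAle ne.
  by move/(_ j'); rewrite lt2 => /(_ isT); rewrite leqNgt (ltnW j'j).
exists j; split=> //; last by case/orP: jP => [|/eqP]; auto.
case: j jP jmin lt => [|j] jP jmin lt; first by rewrite a0.
rewrite leqNgt; apply/negP => h1.
by move: (jmin j); rewrite h1 => /(_ isT); rewrite ltnn.
Qed.

Variables (A A' : choiceType) (L L' B : Type).
Variables (M : lts A L Q) (M' : lts A' L' Q') (h : B -> A) (h' : B -> A').

(** Suffixes from related positions are again in [stutter]. For [PUntil] a witness [i] goes to the
    least block containing it, and a witness [j] to the time [a j]. *)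
Lemma psat_stutter (d : nat) :
  (forall (f : sform B) q q', sdepth f <= d -> R q q' ->
     ssat M q (ssubst h f) <-> ssat M' q' (ssubst h' f)) ->
  forall (f : pform B) p p', pdepth f <= d -> stutter p p' ->
     psat M p (psubst h f) <-> psat M' p' (psubst h' f).
Proof.
move=> HS; elim=> [f|f IH|f1 IH1 f2 IH2|f1 IH1 f2 IH2] p p' /=.
- move=> df [a [a0 mono _ aR]]; apply: HS => //; apply: aR; rewrite a0 //.
  by right.
- by move=> df /(IH _ _ df) ->.
- by rewrite geq_max => /andP[d1 d2] m; rewrite (IH1 _ _ d1 m) (IH2 _ _ d2 m).
rewrite geq_max => /andP[d1 d2] [a [a0 mono unb aR]].
have mono' := nondecreasing_leq mono.
split=> [[i [p2 p1]]|[j [p2 p1]]].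
- have [j [h1 h2 h3]] := stutter_index i a0 mono unb.
  have m := stutter_suffix mono unb aR h1 h2.
  exists j; split; first by rewrite -(IH2 _ _ d2 m).
  move=> j' /h3 lt; have m' : stutter (suffix_from (a j') p) (suffix_from j' p').
    by apply: (stutter_suffix mono unb aR) => //; right.
  by rewrite -(IH1 _ _ d1 m'); apply: p1.
- exists (a j); split.
    have m' : stutter (suffix_from (a j) p) (suffix_from j p').
      by apply: (stutter_suffix mono unb aR) => //; right.
    by rewrite (IH2 _ _ d2 m').
  move=> i ij; have [j' [h1 h2 h3]] := stutter_index i a0 mono unb.
  rewrite (IH1 _ _ d1 (stutter_suffix mono unb aR h1 h2)); apply: p1.
  by rewrite ltnNge; apply/negP => /mono'; lia.
Qed.

End Stutter.

(** * Imitating a path of one system in another *)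

Section Simulation.
Variables (AP : choiceType) (Sint : Type) (P : template AP Sint) (k d : nat).

Definition cls (G : topology) (g : 'I_k -> vertex G) (s : sys_state P G) :=
  (gst g s, ty g d (tok s)).

Definition valid (G : topology) (s : sys_state P G) : Prop := carries s (tok s).

Variables (G H : topology) (g : 'I_k -> vertex G) (h : 'I_k -> vertex H).
Hypothesis same_pattern : forall i j, (g i == g j) = (h i == h j).
Hypothesis same_segments : forall i,
  segments g (ty g d) (g i) = segments h (ty h d) (h i).

Definition sim (s : sys_state P G) (s' : sys_state P H) : Prop :=
  [/\ valid s, valid s' & cls g s = cls h s'].

Variables (p : nat -> sys_state P G) (pP : is_path (system P G) p).
Hypothesis p0 : valid (p 0).
Let tau n := tok (p n).
Let pn n : carries (p n) (tau n). Proof. exact (path_carries pP p0 n). Qed.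
Let tp : token_path tau. Proof. exact (tok_path pP p0). Qed.

Definition in_cls n (s : sys_state P H) := valid s /\ cls g (p n) = cls h s.

(* To imitate p it is not enough to stay in the same class of level d: the future
   word of the token of p must also be available in H. *)
Definition committed n (s : sys_state P H) : Prop :=
  exists tau' n' l e, [/\ token_path tau', fit g (ty g d) tau n l e,
    fit h (ty h d) tau' n' l e, carries s (tau' n') & gst g (p n) = gst h s].

Lemma committed_cls n s : committed n s -> in_cls n s.
Proof.
move=> [tau' [n' [l [e [tp' f f' sc gE]]]]]; split; first by rewrite /valid (tokE sc).
rewrite /cls gE (tokE sc); case: (fit_head f) (fit_head f') => l1 -> [l2 []].
by move=> <- _.
Qed.

(** Drives the token along [tau'] through the first class of [l] up to the edge that leaves it. The
    condition on [e] and [l] excludes a class that never changes again. *)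
Lemma fit_advance (C : sys_state P H -> Prop) tau' n' l e s :
  token_path tau' -> fit h (ty h d) tau' n' l e -> carries s (tau' n') ->
  (forall s1 u, carries s1 u -> ty h d u = ty h d (tau' n') ->
     gst h s1 = gst h s -> C s1) ->
  ~ (exists b, e = inr b) \/ 1 < size l ->
  exists m n s1, let v := tau' m in let w := tau' m.+1 in
    [/\ run C n s s1, carries s1 v, gst h s1 = gst h s,
        ty h d v = ty h d (tau' n') /\ edge v w &
        (l = [:: ty h d v] /\ e = inl (pos h w)) \/
        (pos h w = set0 /\
          exists2 l', l = ty h d v :: l' & fit h (ty h d) tau' m.+1 l' e)].
Proof.
move=> tp' f; have st := tp'.1.
elim: f s => {n' l e} [n b _ _|n neq pw|n l e eq f IH|n l e neq pw f _] s sv HC.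
- by case=> //; case; exists b.
- move=> _; exists n, 0, s; split=> //; [exact: run0| |by left].
  by split=> //; case: (st n) => // E; rewrite E eqxx in neq.
- move=> hl; case: (st n) => [E|vw].
    case: (IH s _ _ hl) => [||m [n1 [s1 [r1 ? ? [? ?] ?]]]]; rewrite ?E //.
    by exists m, n1, s1; split=> //; split=> //; rewrite -E.
  have [pv pw] := same_ty_edge vw eq.
  (* Both ends of an edge inside a class are unobserved, so the prescribed target states are
     dummies. *)
  have [| | |n1 [s1 [r1 s1w _ _ eqs]]] :=
    @tok_move _ _ P _ _ h C s _ _ (s (tau' n)) (s (tau' n)) _ sv vw.
  - by move=> s1 s1v gE; apply: (HC s1 (tau' n)).
  - by rewrite pv eqxx.
  - by rewrite pw eqxx.
  have gE : gst h s1 = gst h s.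
    apply/ffunP => i; rewrite !ffunE eqs //; apply/eqP => E.
      by move/setP/(_ i): pv; rewrite !inE E eqxx.
    by move/setP/(_ i): pw; rewrite !inE E eqxx.
  case: (IH s1 s1w _ hl) => [s2 u cu tu gu|m [n2 [s2 [r2 c2 g2 [t2 e2] c]]]].
    by apply: (HC s2 u); rewrite // ?gu ?tu.
  exists m, (n1.+1 + n2), s2; split=> //; first exact: run_cat r1 r2.
  - by rewrite g2.
  - by rewrite t2 eq.
- move=> _; exists n, 0, s; split=> //; first exact: run0.
    by split=> //; case: (st n) => // E; rewrite E eqxx in neq.
  by right; split=> //; exists l.
Qed.

(** The class of [p] changes for one of two reasons. Either an observed process takes an internal
    step, which is copied, or the token moves to a vertex of another type, and the token of [H]
    follows its own word to such a vertex. *)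
Lemma round_move n m s : committed n s -> n < m ->
  (forall i, n <= i < m -> cls g (p i) = cls g (p n)) ->
  cls g (p m) <> cls g (p n) ->
  exists len s2, run (in_cls n) len.+1 s s2 /\ committed m s2.
Proof.
case: m => // m cm; rewrite ltnS => nm cst neq.
have sC := committed_cls cm; have gtau i : ty g d (tau i) = (cls g (p i)).2 by [].
have cm0 : cls g (p m) = cls g (p n) by apply: cst; rewrite nm leqnn.
case: cm => tau' [n' [l [e [tp' f f' sc gE]]]].
have {}f : fit g (ty g d) tau m l e.
  by apply: fit_const f => // i hi; rewrite !gtau cst.
have {}gE : gst g (p m) = gst h s by case: cm0 => ->.
have HC s1 u : carries s1 u -> ty h d u = ty h d (tau' n') ->
     gst h s1 = gst h s -> in_cls n s1.
  move=> cu tu gu; split; first by rewrite /valid (tokE cu).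
  rewrite sC.2 /cls gu (tokE cu) (tokE sc) tu //.
have gEi i : p m (g i) = s (h i) by move/ffunP/(_ i): gE; rewrite !ffunE.
case: (pP m) => [[a /(step_inv (pn m))]|[_ E]]; last by case: neq; rewrite E cm0.
case=> [[x [b [px eqs pv]]]|[w [vw p1 p2 eqs pw]]].
  have tE : tau m.+1 = tau m by rewrite /tau /= (tokE pv).
  have [pos0|/set0Pn[i]] := eqVneq (pos g x) set0.
    case: neq; rewrite -cm0 /cls (gst_eq pos0 eqs); congr pair.
    by rewrite -[tok _]/(tau m.+1) tE.
  rewrite inE => /eqP gi; rewrite -gi in px eqs.
  have sx : intern (s (h i)) (p m.+1 (g i)) by apply/asboolP; exists b; rewrite -gEi.
  have [[a' sa] uc] := internal_step sc sx.
  exists 0, (upd s (h i) (p m.+1 (g i))); split.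
    by apply: runS; [exact: sC|left; exists a'; apply: sa|exact: run0].
  exists tau', n', l, e; split=> //.
    case: (fitS f) => [[]//|[]|[]]; by rewrite tE eqxx.
  apply/ffunP => j; rewrite !ffunE -same_pattern; case: eqP => [->//|/eqP ji].
  by rewrite eqs // gEi.
have twE : tau m.+1 = w by rewrite /tau /= (tokE pw).
(* A token move inside one type has unobserved ends and would keep the class. *)
have tvw : ty g d w <> ty g d (tau m).
  move=> eq; have [pv0 pw0] := same_ty_edge vw eq; case: neq; rewrite -cm0 /cls.
  rewrite (tokE pw) eq; congr pair; apply/ffunP => i; rewrite !ffunE eqs //.
    by apply/eqP => E; move/setP/(_ i): pv0; rewrite !inE E eqxx.
  by apply/eqP => E; move/setP/(_ i): pw0; rewrite !inE E eqxx.
have := fitS f; rewrite twE => fS.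
have side : ~ (exists b, e = inr b) \/ 1 < size l.
  case: fS => [[/tvw []]|[_ _ _ ->]|[_ _ [l' -> f1]]].
  - by left; case.
  - by right; case: (fit_head f1) => l2 ->.
have [m' [n1 [s1 [r1 s1v g1 [t1 vw'] c1]]]] := fit_advance tp' f' sc HC side.
set v' := tau' m' in s1v t1 vw' c1; set w' := tau' m'.+1 in vw' c1.
have posv : pos g (tau m) = pos h v'.
  by apply: (@ty_pos _ _ _ _ _ d); rewrite t1 gtau cm0 sC.2 /= (tokE sc).
(* Both tokens read the same [l] and [e], so one enters an observed vertex exactly when the other
   does, with the same set of indices. *)
have posw : pos g w = pos h w'.
  case: fS => [[/tvw []]|[_ pwn lE eE]|[_ pw0 [l' lE f1]]].
  - case: c1 => [[_]|[_ [l2]]]; first by rewrite eE => -[].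
    by rewrite lE => -[_ <-] /fit_head[].
  - case: c1 => [[]|[-> _ //]]; rewrite lE => -[_ l'0].
    by move: f1; rewrite l'0 => /fit_head[].
have g1i i : p m (g i) = s1 (h i).
  by rewrite gEi; move/ffunP/(_ i): g1; rewrite !ffunE.
have HC1 : forall s2, carries s2 v' -> gst h s2 = gst h s1 -> in_cls n s2.
  by move=> s2 c2 g2; apply: (HC s2 v'); rewrite // ?g2.
have [||n2 [s2 [r2 s2w q1 q2 eqs2]]] :=
  @tok_move _ _ P _ _ h _ s1 v' w' (p m.+1 (tau m)) (p m.+1 w) HC1 s1v vw'.
- case/set0Pn => i iv; have : i \in pos g (tau m) by rewrite posv.
  by move: iv; rewrite !inE => /eqP <- /eqP gi; rewrite -g1i gi.
- case/set0Pn => i iw; have : i \in pos g w by rewrite posw.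
  by move: iw; rewrite !inE => /eqP <- /eqP gi; rewrite -g1i gi.
have gE2 : gst g (p m.+1) = gst h s2.
  apply/ffunP => i; rewrite !ffunE.
  have iv : (g i == tau m) = (h i == v') by move/setP/(_ i): posv; rewrite !inE.
  have iw : (g i == w) = (h i == w') by move/setP/(_ i): posw; rewrite !inE.
  have [E|nv] := eqVneq (h i) v'.
    move: iv; rewrite E eqxx => /eqP ->; rewrite q1 //.
    by apply/set0Pn; exists i; rewrite inE E.
  have [E|nw] := eqVneq (h i) w'.
    move: iw; rewrite E eqxx => /eqP ->; rewrite q2 //.
    by apply/set0Pn; exists i; rewrite inE E.
  by rewrite eqs ?iv ?iw // eqs2.
exists (n1 + n2), s2; split; first by rewrite -addnS; apply: run_cat r1 r2.
case: fS => [[/tvw []]|[_ pwn lE eE]|[_ pw0 [l' lE f1]]].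
  (* The word is used up when the token enters an observed vertex [g i]. A new one is read off
     [tau], and [same_segments] provides a token path from [h i] with that word. *)
  have [x fx] := segments_exist g d m.+1 tp.
  case/set0Pn: pwn => i; rewrite inE => /eqP gi.
  have : x \in segments g (ty g d) (g i).
    by rewrite inE; apply/asboolP; exists tau, m.+1; split=> //; rewrite twE.
  rewrite same_segments inE => /asboolP[tau2 [n3 [tp2 t2 f2]]].
  exists tau2, n3, x.1, x.2; split=> //; rewrite t2.
  suff -> : h i = w' by [].
  by apply/eqP; move/setP/(_ i): posw; rewrite !inE gi eqxx.
case: c1 => [[]|[_ [l2]]]; rewrite lE.
  by move=> [_ l'0]; move: f1; rewrite l'0 => /fit_head[].
move=> [_ <-] f2; exists tau', m'.+1, l', e; split=> //.
Qed.

(** [D] is a coinductive witness that a path from [s] can stay forever in the final class of [p]. *)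
Definition resting n (s : sys_state P H) : Prop :=
  (forall m, n <= m -> cls g (p m) = cls g (p n)) /\
  exists D : sys_state P H -> Prop, D s /\
    forall s1, D s1 -> in_cls n s1 /\ exists2 s2, D s2 & max_step s1 s2.

(** The word is a single type, and its flag tells whether the token gets stuck. [D] collects the
    states with the token on [tau'] from time [n'] on and the observed processes as in [s]. *)
Lemma committed_rest n s : committed n s ->
  (forall m, n <= m -> cls g (p m) = cls g (p n)) -> resting n s.
Proof.
move=> cm cst; split=> //; have sC := committed_cls cm.
case: cm => tau' [n' [l [e [tp' f f' sc gE]]]].
have [lE [b eE bE]] : l = [:: ty g d (tau n)] /\
    exists2 b : bool, e = inr b & (b <-> ev_const tau).
  by apply: fit_const_end f => m /cst [].
rewrite {}lE {}eE in f'; have [cst' bE'] := fit_inr f'.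
exists (fun s1 => exists2 m, n' <= m & carries s1 (tau' m) /\ gst h s1 = gst h s).
split; first by exists n'.
move=> s1 [m nm [c1 g1]]; split.
  split; first by rewrite /valid (tokE c1).
  by rewrite sC.2 /cls g1 (tokE c1) (tokE sc) cst'.
have [stuck|] := pselect (forall m2, m <= m2 -> tau' m2 = tau' m).
  have noedge := tp'.2 m stuck.
  have [dl|] := pselect (deadlock (system P H) s1).
    by exists s1; [exists m|right].
  move=> /contrapT[a [s2 st]]; exists s2; last by left; exists a.
  case: (step_inv c1 st) => [[x [b' [sx eqs c2]]]|[w [vw]]]; last first.
    by move: (noedge w); rewrite vw.
  exists m => //; split=> //; rewrite -g1; apply: (@gst_eq _ _ _ _ _ h s1 s2 x) => //.
  apply/eqP/set0Pn => -[i]; rewrite inE => /eqP hi.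
  (* The flags agree, so the token of [p] gets stuck too and [p] reaches a deadlock, where the
     observed process [g i] cannot take the internal step of [h i]. *)
  have [N cN] : ev_const tau by apply/bE/bE'; exists m.
  have [|m3 nm3 dl] := @stuck_deadlock _ _ _ _ _ pP _ p0 (maxn n N).
    by move=> m4; rewrite geq_max => /andP[_ N4]; rewrite -!/(tau _) cN // cN // leq_maxr.
  have := deadlock_settled (g i) dl (s2 x); move/negP; case; apply/asboolP; exists b'.
  have [gE3 _] := cst m3 (leq_trans (leq_maxl _ _) nm3).
  have -> : p m3 (g i) = s1 x.
    rewrite -hi; move/ffunP/(_ i): gE3; rewrite gE -g1 !ffunE //.
  by [].
move=> moves.
(* At time [m1] the path [tau'] leaves the current vertex. An end of that edge that is not settled
   takes an internal step; if both are settled the token moves. *)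
have [m1 [mm1 m1E vw]] : exists m1, [/\ m <= m1, tau' m1 = tau' m & edge (tau' m1) (tau' m1.+1)].
  apply: contrapT => no; apply: moves => m2 /subnKC <-.
  elim: (m2 - m) => [|r IH]; rewrite ?addn0 // addnS.
  case: (tp'.1 (m + r)) => [-> //|vw]; case: no; exists (m + r).
  by split=> //; exact: leq_addr.
have nm1 : n' <= m1 by exact: leq_trans mm1.
have [pv pw] : pos h (tau' m1) = set0 /\ pos h (tau' m1.+1) = set0.
  by apply: (@same_ty_edge _ _ _ d) => //; rewrite !cst' // ltnW.
rewrite -m1E in c1; have nvw := edge_neq vw.
have internal x q : pos h x = set0 -> intern (s1 x) q ->
    exists2 s2, (exists2 m, n' <= m & carries s2 (tau' m) /\ gst h s2 = gst h s) &
                max_step s1 s2.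
  move=> px sq; have [[a sa] c2] := internal_step c1 sq.
  exists (upd s1 x q); last by left; exists a.
  by exists m1 => //; rewrite gst_upd.
have [sv|/existsNP[q /negP]] := pselect (settled (s1 (tau' m1))); last first.
  by rewrite negbK; apply: internal.
have [sw|/existsNP[q /negP]] := pselect (settled (s1 (tau' m1.+1))); last first.
  by rewrite negbK; apply: internal.
have [q1 h1] : exists q, step P (s1 (tau' m1)) Snd q.
  by apply: settled_snd sv _; rewrite c1.
have [q2 h2] : exists q, step P (s1 (tau' m1.+1)) Rcv q.
  by apply: settled_rcv sw _; rewrite c1 eq_sym.
have [st c2] := tok_step c1 vw h1 h2.
exists (upd (upd s1 (tau' m1) q1) (tau' m1.+1) q2); last by left; exists Tok; apply: st.
by exists m1.+1; rewrite ?leqW // !gst_upd.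
Qed.

Definition progress n s : Prop := committed n s \/ resting n s.

(* Midway through the imitation of the steps of p from time n to time m. *)
Definition pending n len s : Prop :=
  exists m s2, [/\ n < m, forall i, n <= i < m -> cls g (p i) = cls g (p n),
    run (in_cls n) len.+1 s s2 & progress m s2].

Lemma resting_pending n s : resting n s -> pending n 0 s.
Proof.
move=> [cst [D [Ds DP]]]; have [sC [s2 Ds2 st]] := DP s Ds.
exists n.+1, s2; split=> //.
- by move=> i /andP[ni _]; apply: cst.
- by apply: runS st _ => //; apply: run0.
right; split=> [m nm|]; first by rewrite !cst // ltnW.
exists D; split=> // s1 /DP[[v1 c1] st1]; split=> //.
by split=> //; rewrite cst.
Qed.

(** A committed state is resting if the class of [p] never changes again; otherwise [round_move]
    applies up to the first change [m]. *)
Lemma progress_pending n s : progress n s -> exists len, pending n len s.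
Proof.
case=> [cm|/resting_pending]; last by exists 0.
have [cst|] := pselect (forall m, n <= m -> cls g (p m) = cls g (p n)).
  by exists 0; apply/resting_pending/committed_rest.
move=> /existsNP[m0 /not_implyP[nm0 neq0]].
have ex : exists m, (n <= m) && (cls g (p m) != cls g (p n)).
  by exists m0; rewrite nm0; apply/eqP.
have [m /andP[nm /eqP neq] mmin] := ex_minnP ex.
have lt : n < m by rewrite ltn_neqAle nm andbT; apply: contra_notN neq => /eqP ->.
have cst i : n <= i < m -> cls g (p i) = cls g (p n).
  move=> /andP[ni im]; apply: contrapT => /eqP E.
  by have := mmin i; rewrite ni E leqNgt im => /(_ isT).
have [len [s2 [r c]]] := round_move cm lt cst neq.
by exists len, m, s2; split=> //; left.
Qed.

(** The time reached in [p], the number of steps of the current run left after the next one, and the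
    state in [H]. *)
Definition machine : Type := (nat * nat * sys_state P H)%type.

Definition advance (x y : machine) : Prop :=
  let: (n, len, s) := x in let: (n', len', s') := y in
  [/\ in_cls n s, max_step s s', forall i, n <= i < n' -> cls g (p i) = cls g (p n) &
      n = n' /\ len' < len \/ n < n'].

Lemma pending_advance n len s : pending n len s ->
  exists2 y : machine, pending y.1.1 y.1.2 y.2 & advance (n, len, s) y.
Proof.
move=> [m [s2 [nm cst r pr]]]; move El : len.+1 r => l r.
case: r El pr => // {l} l s0 s1 s3 sC st r [El] pr; rewrite -{}El in r.
case: len r => [|len] r.
  have {}pr : progress m s1.
    by move El : 0 r => l0 r; case: r El pr.
  have [len pd] := progress_pending pr.
  by exists (m, len, s1) => //; split=> //; right.
exists (n, len, s1); first by exists m, s3.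
split=> //; last by left; rewrite leqnn.
by move=> i hi; apply: cst; lia.
Qed.

Lemma pending_path n0 len0 s0 : pending n0 len0 s0 ->
  exists2 x : nat -> machine, x 0 = (n0, len0, s0) & forall i, advance (x i) (x i.+1).
Proof.
move=> pd0; pose M := {x : machine | pending x.1.1 x.1.2 x.2}.
have /choice[f fP] (x : M) : exists y : M, advance (sval x) (sval y).
  case: x => [[[n len] s] /= /pending_advance[y py xy]].
  by exists (exist _ y py).
exists (fun i => sval (iter i f (exist _ (n0, len0, s0) pd0))).
  by [].
by move=> i; apply: fP.
Qed.

Lemma committed_path s' : committed 0 s' ->
  exists p', [/\ is_path (system P H) p', p' 0 = s' & stutter sim p p'].
Proof.
move=> cm; have [|len0 pd0] := @progress_pending 0 s'; first by left.
have [x x0 xP] := pending_path pd0; exists (fun j => (x j).2).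
have adv j : [/\ in_cls (x j).1.1 (x j).2, max_step (x j).2 (x j.+1).2,
    forall i, (x j).1.1 <= i < (x j.+1).1.1 -> cls g (p i) = cls g (p (x j).1.1) &
    (x j).1.1 = (x j.+1).1.1 /\ (x j.+1).1.2 < (x j).1.2 \/ (x j).1.1 < (x j.+1).1.1].
  by case: (x j) (x j.+1) (xP j) => [[n len] s] [[n' len'] s1].
split; [by move=> j; case: (adv j)|by rewrite x0|].
exists (fun j => (x j).1.1); split; first by rewrite x0.
- by move=> j; case: (adv j) => _ _ _ [[->]|/ltnW].
- elim=> [|n [j nj]]; first by exists 0.
  (* The step counter cannot decrease forever, so the time in [p] passes every bound. *)
  have [r] := ubnP (x j).1.2; elim: r j nj => // r IH j nj lt.
  case: (adv j) => _ _ _ [[E lt2]|lt2]; last by exists j.+1; apply: leq_ltn_trans lt2.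
  by apply: (IH j.+1); [rewrite -E|exact: leq_trans lt2 lt].
move=> i j ji ij; have [[sv sc] _ cst _] := adv j; split=> //; first exact: pn.
rewrite -sc; case: ij => [lt|-> //]; apply: cst; by rewrite ji.
Qed.

End Simulation.

(** * Similar states satisfy the same formulas *)

Section Equivalence.
Variables (AP : choiceType) (Sint : Type) (P : template AP Sint) (k : nat).
Variables (G H : topology) (g : 'I_k -> vertex G) (h : 'I_k -> vertex H).
Hypothesis same_pattern : forall i j, (g i == g j) = (h i == h j).

(** One level is spent: the type of the token at level [d.+1] supplies the word to commit to through
    [None], and the equality of segments at each [g i] through [Some i]. *)
Lemma sim_path d s s' p : sim d.+1 g h s s' -> is_path (system P G) p -> p 0 = s ->
  exists p', [/\ is_path (system P H) p', p' 0 = s' & stutter (sim d g h) p p'].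
Proof.
move=> [vs vs' [gE tE sE]] pP ps; rewrite -ps in vs gE tE sE.
have segE o : segments g (ty g d) (oapp g (tok (p 0)) o) =
              segments h (ty h d) (oapp h (tok s') o).
  by move/ffunP/(_ o): sE; rewrite !ffunE.
apply: committed_path => //; first by move=> i; apply: (segE (Some i)).
have tp := tok_path pP vs; have [x fx] := segments_exist g d 0 tp.
have : x \in segments g (ty g d) (tok (p 0)).
  by rewrite inE; apply/asboolP; exists (fun n => tok (p n)), 0.
rewrite (segE None) inE => /asboolP[tau' [n' [tp' tn' f']]].
by exists tau', n', x.1, x.2; split=> //; rewrite tn'.
Qed.
End Equivalence.

Lemma sim_sym (AP : choiceType) (Sint : Type) (P : template AP Sint) (k d : nat)
    (G H : topology) (g : 'I_k -> vertex G) (h : 'I_k -> vertex H)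
    (s : sys_state P G) (s' : sys_state P H) :
  sim d g h s s' -> sim d h g s' s.
Proof. by case=> v v' E; split. Qed.

Lemma sys_label_pair (AP : choiceType) (Sint : Type) (P : template AP Sint)
    (G : topology) (s : sys_state P G) (q : AP) (v : vertex G) :
  ((q, v) \in sys_label s) = (q \in label P (s v)).
Proof.
apply/imfset2P/idP => [[u _ [q' /= q's [-> ->]]]//|qv].
by exists v => //; exists q.
Qed.

Definition indexed_atom (AP : Type) (V : Type) (k : nat) (g : 'I_k -> V) (a : AP * 'I_k) :=
  (a.1, g a.2).

(** Induction on [d], then on the formula: a path quantifier lowers the depth by one, as [sim_path]
    lowers the level. The converse direction uses the symmetry of [sim]. *)
Lemma ssat_sim (AP : choiceType) (Sint : Type) (P : template AP Sint) (k d : nat)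
    (G H : topology) (g : 'I_k -> vertex G) (h : 'I_k -> vertex H) :
  (forall i j, (g i == g j) = (h i == h j)) ->
  forall (f : sform (AP * 'I_k)) (s : sys_state P G) (s' : sys_state P H),
    sdepth f <= d -> sim d g h s s' ->
    ssat (system P G) s (ssubst (indexed_atom g) f) <->
    ssat (system P H) s' (ssubst (indexed_atom h) f).
Proof.
move=> pat; elim: d => [|d IHd].
all: elim=> [|[q i]|f IH|f1 IH1 f2 IH2|f] s s' //= df ss'.
all: try by rewrite !sys_label_pair; case: ss' => _ _ [/ffunP/(_ i)]; rewrite !ffunE => ->.
all: try by rewrite (IH _ _ df ss').
all: try by move: df; rewrite geq_max => /andP[d1 d2]; rewrite (IH1 _ _ d1 ss') (IH2 _ _ d2 ss').
have pat' i j : (h i == h j) = (g i == g j) by rewrite pat.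
split=> -[p [pP p0 pf]].
  have [p' [p'P p'0 m]] := sim_path pat ss' pP p0.
  by exists p'; split=> //; rewrite -(psat_stutter IHd df m).
have [p' [p'P p'0 m]] := sim_path pat' (sim_sym ss') pP p0.
have IHd' (f0 : sform (AP * 'I_k)) q q' : sdepth f0 <= d -> sim d h g q q' ->
    ssat (system P H) q (ssubst (indexed_atom h) f0) <->
    ssat (system P G) q' (ssubst (indexed_atom g) f0).
  by move=> df0 /sim_sym ss; split=> /(IHd _ _ _ df0 ss).
by exists p'; split=> //; apply/(psat_stutter IHd' df m).
Qed.

(** * Profiles of topologies and the cutoff *)

(** A back-and-forth type of rank [r], as for Ehrenfeucht-Fraisse games: the set of types of
    one-point extensions, each with the data that decide membership in a [range]. *)
Fixpoint profile_type (d r n : nat) : finType :=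
  match r with
  | 0 => ({set 'I_n * 'I_n} * vtype n d)%type
  | r'.+1 => {set {set 'I_n} * {set 'I_n} * profile_type d r' n.+1}
  end.

Fixpoint profile (d r n : nat) (G : topology) :
    n.-tuple (vertex G) -> profile_type d r n :=
  match r return n.-tuple (vertex G) -> profile_type d r n with
  | 0 => fun g => ([set x | tnth g x.1 == tnth g x.2], ty (tnth g) d (start G))
  | r'.+1 => fun g => [set (pos (tnth g) v, [set i | edge (tnth g i) v],
                            profile d r' (rcons_tuple g v)) | v in vertex G]
  end.

Lemma in_range_profile (G H : topology) n (g : n.-tuple (vertex G))
    (h : n.-tuple (vertex H)) (R : range n) v w :
  pos (tnth g) v = pos (tnth h) w ->
  [set i | edge (tnth g i) v] = [set i | edge (tnth h i) w] ->
  in_range g R v = in_range h R w.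
Proof.
move=> p e; case: R => //= [Y|y]; last by move/setP/(_ y): e; rewrite !inE.
by apply/imsetP/imsetP => -[y yY E]; exists y => //; apply/esym/eqP;
  move/setP/(_ y): p; rewrite !inE E eqxx.
Qed.

Lemma profile_succ d r n (G H : topology) (g : n.-tuple (vertex G))
    (h : n.-tuple (vertex H)) (v : vertex G) :
  profile d r.+1 g = profile d r.+1 h ->
  exists w, (forall R, in_range g R v = in_range h R w) /\
            profile d r (rcons_tuple g v) = profile d r (rcons_tuple h w).
Proof.
move=> /= E; have : (pos (tnth g) v, [set i | edge (tnth g i) v],
    profile d r (rcons_tuple g v)) \in profile d r.+1 g.
  by apply/imsetP; exists v.
rewrite /= E => /imsetP[w _ [p e pE]]; exists w; split=> // R.
exact: in_range_profile.
Qed.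

Lemma init_sim (AP : choiceType) (Sint : Type) (P : template AP Sint)
    (G H : topology) k d (g : 'I_k -> vertex G) (h : 'I_k -> vertex H)
    (s : sys_state P G) (s' : sys_state P H) :
  ty g d (start G) = ty h d (start H) -> sys_init s -> sys_init s' ->
  sim d g h s s'.
Proof.
move=> E si si'; have c := init_carries si; have c' := init_carries si'.
split; rewrite /valid ?(tokE c) ?(tokE c') // /cls (tokE c) (tokE c') E.
congr pair; apply/ffunP => i; rewrite !ffunE si si' !ffunE.
by move/ty_pos/setP/(_ i): E; rewrite !inE => ->.
Qed.

(** Each index quantifier is one back-and-forth move, answered by [profile_succ]; the body is
    settled by [ssat_sim] from the initial states. *)
Lemma isat_at_profile (AP : choiceType) (Sint : Type) (P : template AP Sint) d
    (G H : topology) r n (phi : iform AP r n) (g : n.-tuple (vertex G))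
    (h : n.-tuple (vertex H)) :
  idepth phi <= d -> profile d r g = profile d r h ->
  isat_at P phi g <-> isat_at P phi h.
Proof.
elim: phi g h => {r n} [n f|r n Q R phi IH] g h dphi E.
  case: E => /= pat tyE.
  have pat' i j : (tnth g i == tnth g j) = (tnth h i == tnth h j).
    by move/setP/(_ (i, j)): pat; rewrite !inE.
  split=> sat s si.
    pose s0 : sys_state P G := [ffun v => if v == start G then iota_t P else iota_n P].
    by apply/(ssat_sim pat' dphi (init_sim tyE (erefl s0) si)); apply: sat.
  pose s0 : sys_state P H := [ffun v => if v == start H then iota_t P else iota_n P].
  by apply/(ssat_sim pat' dphi (init_sim tyE si (erefl s0))); apply: sat.
move: dphi => /= dphi; have [to fro] := (fun v => profile_succ v E, fun v => profile_succ v (esym E)).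
case: Q => /=; split.
- move=> sat w hw; have [v [rE pE]] := fro w.
  by apply/(IH _ _ dphi (esym pE)); apply: sat; rewrite -rE.
- move=> sat v hv; have [w [rE pE]] := to v.
  by apply/(IH _ _ dphi pE); apply: sat; rewrite -rE.
- move=> [v [hv sat]]; have [w [rE pE]] := to v.
  by exists w; rewrite -rE; split=> //; apply/(IH _ _ dphi pE).
- move=> [w [hw sat]]; have [v [rE pE]] := fro w.
  by exists v; rewrite -rE; split=> //; apply/(IH _ _ dphi (esym pE)).
Qed.

Theorem theorem5 (AP : countType) (Sint : finType)
    (AP_infinite : infinite_type AP) (Sint_nonempty : 0 < #|Sint|)
    (GG : topology -> Prop) (k d : nat) (k_gt0 : 0 < k) (d_gt0 : 0 < d) :
  exists c : nat,
    forall (P : template AP Sint) (phi : iform AP k 0), idepth phi <= d ->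
      ((forall G, GG G -> gsize G <= c -> isat P G phi) <->
       (forall G, GG G -> isat P G phi)).
Proof.
pose prof G := profile d k ([tuple] : 0.-tuple (vertex G)).
(* [f t] is the size of a chosen topology of [GG] with profile [t]. If there is none the value is 0,
   which cannot raise the maximum. *)
have /choice[f fP] (t : profile_type d k 0) : exists n,
    (exists2 G, GG G & prof G = t) -> exists G, [/\ GG G, prof G = t & gsize G = n].
  have [[G GG_G GE]|no] := pselect (exists2 G, GG G & prof G = t); last by exists 0.
  by exists (gsize G) => _; exists G.
exists (\max_t f t) => P phi dphi; split=> [sat G GG_G|sat G GG_G _]; last exact: sat.
have [|H [GG_H HE sH]] := fP (prof G); first by exists G.
apply/(isat_at_profile P dphi (esym HE)); apply: sat => //.
by rewrite sH; apply: leq_bigmax.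
Qed.
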